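(* Let $1\le t\le s\le r/2$ be integers, and let $H$ be an $r$-uniform hypergraph on a finite vertex set $V$, $|V|=n\ge r$, such that every $s$-subset of $V$ is contained in at least one edge. For $S\subseteq\binom{V}{s}$ and $T\subseteq\binom{V}{t}$, let $$e(S,T)=\frac{|E(S,T)|}{\left|E\left(\binom{V}{s},\binom{V}{t}\right)\right|}.$$ Then $$|e(S,T)-e(S)e(T)|\le\bar\lambda^{(s)}\sqrt{e(S)\,e(T)\,e(\bar S)\,e(\bar T)}.$$
   Context: $\binom{V}{s}$ is the set of $s$-subsets of $V$, and $V^{\underline{s}}$ the set of ordered $s$-tuples of distinct elements of $V$; for $x\in V^{\underline{s}}$, $[x]$ is the $s$-set of its coordinates. An $r$-uniform hypergraph $H$ has edge set $E(H)\subseteq\binom{V}{r}$; for a set $x\subseteq V$ with $|x|<r$, $d_x$ is the number of edges of $H$ containing $x$. For $1\le j\le r-1$ and $S\subseteq\binom{V}{j}$: $\mathrm{vol}(S)=\sum_{x\in S}d_x$, so $\mathrm{vol}(\binom{V}{j})=|E(H)|\binom{r}{j}$; the density of $S$ is $e(S)=\mathrm{vol}(S)/\mathrm{vol}(\binom{V}{j})$; $\bar S=\binom{V}{j}\setminus S$, so $e(\bar S)=1-e(S)$. For $S\subseteq\binom{V}{s}$, $T\subseteq\binom{V}{t}$, $E(S,T)$ is the set of triples $(x,y,F)$ with $x\in S$, $y\in T$, $x\cap y=\emptyset$, $F\in E(H)$, $x\cup y\subseteq F$ (i.e. edges are counted with multiplicity); in particular $|E(\binom{V}{s},\binom{V}{t})|=|E(H)|\frac{r!}{s!\,t!\,(r-s-t)!}$.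 For $1\le s\le r/2$, $G^{(s)}$ is the weighted undirected graph on $V^{\underline{s}}$ with $w(x,y)=|\{F\in E(H):[x]\cup[y]\subseteq F\}|$ if $[x]\cap[y]=\emptyset$ and $w(x,y)=0$ otherwise. With $A=(w(x,y))$ and $D=\mathrm{diag}\big(\sum_y w(x,y)\big)$, the $s$-th Laplacian is $\mathcal L^{(s)}=I-D^{-1/2}AD^{-1/2}$; its eigenvalues in non-decreasing order with multiplicity are $\lambda_0^{(s)}\le\lambda_1^{(s)}\le\cdots\le\lambda_{\max}^{(s)}$, and $\bar\lambda^{(s)}=\max\{|1-\lambda_1^{(s)}|,|1-\lambda_{\max}^{(s)}|\}$. *)

(* Defs.v *)
From mathcomp Require Import all_boot all_order all_algebra.
From mathcomp Require Import reals polyrcf.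

Set Implicit Arguments.
Unset Strict Implicit.
Unset Printing Implicit Defensive.

Import Order.TTheory GRing.Theory Num.Theory.
Local Open Scope ring_scope.

(* A hypergraph on V is given by its edge set H : {set {set V}}. *)
Definition uniform (V : finType) (r : nat) (H : {set {set V}}) : Prop :=
  forall F : {set V}, F \in H -> #|F| = r.

Definition ksubsets (V : finType) (j : nat) : {set {set V}} :=
  [set x : {set V} | #|x| == j].

Definition deg (V : finType) (H : {set {set V}}) (x : {set V}) : nat :=
  #|[set F in H | x \subset F]|.

Definition vol (V : finType) (H : {set {set V}}) (S : {set {set V}}) : nat :=
  (\sum_(x in S) deg H x)%N.

Definition density (R : realType) (V : finType) (H : {set {set V}}) (j : nat)
    (S : {set {set V}}) : R :=
  (vol H S)%:R / (vol H (ksubsets V j))%:R.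

(* Triples (x, y, F): an edge F is counted once for each admissible (x, y). *)
Definition edges_between (V : finType) (H S T : {set {set V}}) :
    {set {set V} * {set V} * {set V}} :=
  [set p : {set V} * {set V} * {set V} |
    [&& p.1.1 \in S, p.1.2 \in T, [disjoint p.1.1 & p.1.2],
        p.2 \in H & (p.1.1 :|: p.1.2) \subset p.2]].

Definition edge_density (R : realType) (V : finType) (H : {set {set V}})
    (s t : nat) (S T : {set {set V}}) : R :=
  #|edges_between H S T|%:R
    / #|edges_between H (ksubsets V s) (ksubsets V t)|%:R.

Definition dtuple (V : finType) (s : nat) := {x : s.-tuple V | uniq x}.

Definition support_set (V : finType) (s : nat) (x : dtuple V s) : {set V} :=
  [set v in val x].

Definition weight (V : finType) (H : {set {set V}}) (s : nat)
    (x y : dtuple V s) : nat :=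
  if [disjoint support_set x & support_set y]
  then #|[set F in H | support_set x :|: support_set y \subset F]|
  else 0%N.

(* Rows and columns are indexed by s-tuples of distinct vertices through
   [enum_val]. *)
Definition adjacency (R : realType) (V : finType) (H : {set {set V}})
    (s : nat) : 'M[R]_#|{: dtuple V s}| :=
  \matrix_(i, j) (weight H (enum_val i) (enum_val j))%:R.

(* D^{-1/2}, where D is the diagonal matrix of the row sums of [adjacency]. *)
Definition degree_invsqrt (R : realType) (V : finType) (H : {set {set V}})
    (s : nat) : 'M[R]_#|{: dtuple V s}| :=
  diag_mx (\row_i (Num.sqrt (\sum_j adjacency R H s i j))^-1).

Definition laplacian (R : realType) (V : finType) (H : {set {set V}})
    (s : nat) : 'M[R]_#|{: dtuple V s}| :=
  1%:M - degree_invsqrt R H s *m adjacency R H s *m degree_invsqrt R H s.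

(* The real eigenvalues in non-decreasing order, each repeated according to its
   multiplicity as a root of the characteristic polynomial; [rootsR] lists the
   distinct real roots increasingly. For a symmetric matrix these are all n
   eigenvalues. *)
Definition spectrum (R : realType) (n : nat) (A : 'M[R]_n) : seq R :=
  flatten [seq nseq (mup a (char_poly A)) a | a <- rootsR (char_poly A)].

(* The k-th Laplacian eigenvalue, counted from 0. *)
Definition lambda (R : realType) (V : finType) (H : {set {set V}})
    (s k : nat) : R :=
  nth 0 (spectrum (laplacian R H s)) k.

Definition lambda_max (R : realType) (V : finType) (H : {set {set V}})
    (s : nat) : R :=
  last 0 (spectrum (laplacian R H s)).

Definition lambda_bar (R : realType) (V : finType) (H : {set {set V}})
    (s : nat) : R :=
  Num.max `|1 - lambda R H s 1| `|1 - lambda_max R H s|.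

(* Main.v *)
Require Import Defs.
From mathcomp Require Import all_boot all_order all_algebra.
From mathcomp Require Import reals.
From mathcomp Require Import polyrcf complex ring zify.
Import Order.TTheory GRing.Theory Num.Theory.
Local Open Scope ring_scope.
Local Open Scope sesquilinear_scope.

(* The inequality is the expander mixing lemma for the weighted graph G^(s),
   applied to the functions f(x) = 1_S([x]) and
   g(y) = #{z in T | z \subset [y]} / C(s, t), both with values in [0, 1].
   Averaging the indicator of T over the t-subsets of [y] makes the bilinear
   form of G^(s) and the two weighted means proportional to |E(S, T)|, vol S and
   vol T by double counting; since 0 <= g <= 1 forces g^2 <= g, the variance of
   g is still at most e(T)(1 - e(T)).
   The mixing lemma follows from the spectral theorem for the Laplacian, taken
   over the complex extension of R, and Cauchy-Schwarz after centering. *)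

(** * Spectra of real symmetric matrices *)

Lemma sorted_spectrum (R : realType) (n : nat) (A : 'M[R]_n) :
  sorted <=%R (spectrum A).
Proof.
rewrite /spectrum /rootsR.
have := sorted_roots (- cauchy_bound (char_poly A)) (cauchy_bound (char_poly A)) (char_poly A).
elim: (roots _ _ _) => //= a s IHs pa.
have {IHs} IH := IHs (path_sorted pa).
have /allP lta := order_path_min lt_trans pa.
elim: (mup a _) => //= k IHk.
rewrite (path_sortedE le_trans) IHk andbT all_cat; apply/andP; split.
  by apply/allP => x /nseqP[-> _].
apply/allP => x /flattenP[l /mapP[b bs ->]] /nseqP[-> _].
exact/ltW/lta.
Qed.

Lemma count_mem_spectrum (R : realType) (n : nat) (A : 'M[R]_n) (a : R) :
  count_mem a (spectrum A) = mup a (char_poly A).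
Proof.
have p0 : char_poly A != 0 by rewrite monic_neq0 ?char_poly_monic.
rewrite /spectrum count_flatten -map_comp sumnE big_map.
have ur : uniq (rootsR (char_poly A)).
  exact: (sorted_uniq lt_trans ltxx (sorted_roots _ _ _)).
case: (boolP (root (char_poly A) a)) => ra; last first.
  rewrite (mupNroot ra) big_seq big1 // => b bs /=; rewrite count_nseq /=.
  have [ba|] := eqVneq b a; last by rewrite mul0n.
  by move: bs; rewrite ba -(roots_on_rootsR p0) (negPf ra) andbF.
have ar : a \in rootsR (char_poly A).
  by rewrite -(roots_on_rootsR p0) ra in_itv.
rewrite (bigD1_seq a) //= count_nseq /= eqxx mul1n big1 ?addn0 // => b ba.
by rewrite count_nseq /= (negPf ba) mul0n.
Qed.

Lemma char_poly_conj {C : numClosedFieldType} {n : nat} {P D : 'M[C]_n} :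
  P \is unitarymx -> char_poly (P^t* *m D *m P) = char_poly D.
Proof.
move=> PU; have Pu := unitarymx_unit PU; rewrite -invmx_unitary //.
pose L := map_mx (@polyC C); have LP : L n n P \in unitmx.
  by rewrite unitmxE det_map_mx rmorph_unit // -unitmxE.
rewrite /char_poly; suff -> : char_poly_mx (invmx P *m D *m P) =
    invmx (L n n P) *m char_poly_mx D *m L n n P.
  by rewrite !det_mulmx mulrC mulrA -det_mulmx mulmxV // det1 mul1r.
rewrite /char_poly_mx mulmxBr mulmxBl mul_mx_scalar -scalemxAl mulVmx // scalemx1.
by rewrite !map_mxM map_invmx.
Qed.

(** Over [R[i]] a real symmetric matrix is Hermitian, so the spectral theorem gives a unitary [P]
    and real diagonal entries. The [perm_eq] ties these entries, with multiplicity, to the list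
    through which the eigenvalues are defined. *)
Lemma symmetric_diagonalization {R : realType} {n : nat} {A : 'M[R]_n} :
  A^T = A ->
  exists (P : 'M[R[i]]_n) (d : 'I_n -> R),
    [/\ P \is unitarymx,
        map_mx (real_complex R) A
          = P^t* *m diag_mx (\row_k (real_complex R (d k))) *m P
      & perm_eq (spectrum A) [seq d k | k <- enum 'I_n]].
Proof.
move=> symA; set AC := map_mx _ A.
have AC_real : AC \is a realmx.
  by apply/mxOverP => i j; rewrite mxE; apply/complex_realP; exists (A i j).
have AC_herm : AC \is hermsymmx.
  apply: realsym_hermsym => //; apply/is_hermitianmxP.
  by rewrite expr0 scale1r map_mx_id // /AC map_trmx symA.
have /orthomx_spectralP eAC := hermitian_normalmx AC_herm.
have PU := spectral_unitarymx AC.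
move: (spectralmx AC) (spectral_diag AC) (hermitian_spectral_diag_real AC_herm) PU eAC.
move=> P D Dr PU eAC.
pose d k := complex.Re (D 0 k).
have eD : D = \row_k (real_complex R (d k)).
  apply/rowP => k; rewrite mxE RRe_real //; exact: (mxOverP Dr).
rewrite invmx_unitary // eD in eAC.
exists P, d; split=> //.
(* Both lists have equal counts once the characteristic polynomial factors over [R] as the product
   of the ['X - (d k)%:P]; that factorization is checked after the injective passage to [R[i]]. *)
suff cA : char_poly A = \prod_(a <- [seq d k | k <- enum 'I_n]) ('X - a%:P).
  by apply/allP => a _; rewrite /= count_mem_spectrum cA mu_prod_XsubC.
apply: (map_poly_inj (real_complex R)).
rewrite map_char_poly -/AC eAC (char_poly_conj PU) char_poly_trig ?diag_mx_is_trig //.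
rewrite rmorph_prod /= big_map big_enum /=; apply: eq_bigr => k _.
by rewrite rmorphB /= map_polyX map_polyC !mxE eqxx mulr1n.
Qed.

(** If the entry at index 1 exceeded [a], so would all later ones, leaving at most one entry that
    does not. This gives access to the second smallest eigenvalue by counting. *)
Lemma nth1_sorted_le {R : realType} (s : seq R) (a : R) :
  sorted <=%R s -> (1 < count (fun b => (b <= a)%R) s)%N -> nth 0 s 1 <= a.
Proof.
case: s => [|b [|c s]] //=; first by case: (b <= a).
move=> /andP[_ pc]; have /allP cs := order_path_min le_trans pc.
rewrite [c <= a]leNgt; case: ltP => //= ac.
rewrite add0n (_ : count _ s = 0%N) ?addn0; first by case: (b <= a).
apply/eqP; rewrite -leqn0 leqNgt -has_count; apply/hasPn => x /cs cx.
by rewrite -ltNge (lt_le_trans ac).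
Qed.

Lemma le_last {R : realType} (s : seq R) (a : R) :
  sorted <=%R s -> a \in s -> a <= last 0 s.
Proof.
elim/last_ind: s => // s b _; rewrite last_rcons mem_rcons inE.
move=> ss /predU1P[->//|sa].
have := ss; rewrite -(rev_sorted) rev_rcons /= => pa.
have /allP := order_path_min (fun _ _ _ h1 h2 => le_trans h2 h1) pa.
by apply; rewrite mem_rev.
Qed.

(** * Norm bound for [1 - A] on the orthogonal complement of a kernel vector *)

Definition sqnorm {R : realType} {n : nat} (x : 'cV[R]_n) : R := \sum_i x i 0 ^+ 2.

Definition dotv {R : realType} {n : nat} (x y : 'cV[R]_n) : R := \sum_i x i 0 * y i 0.

(** An eigenvector [v] gives a quadratic form value [a] times the squared norm of [v]. The transpose
    appears because [eigenvalueP] supplies a row vector with [v *m A = a *: v]. *)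
Lemma spectrum_ge0 {R : realType} {n : nat} (A : 'M[R]_n) (a : R) :
  (forall x : 'cV[R]_n, 0 <= dotv x (A^T *m x)) -> a \in spectrum A -> 0 <= a.
Proof.
move=> psd; rewrite -has_pred1 has_count count_mem_spectrum.
rewrite -XsubC_dvd ?monic_neq0 ?char_poly_monic // dvdp_XsubCl.
rewrite -eigenvalue_root_char => /eigenvalueP[v vA v0].
have := psd v^T; rewrite -trmx_mul vA /dotv.
rewrite (eq_bigr (fun i => a * v 0 i ^+ 2)) => [|i _]; last by rewrite !mxE; ring.
rewrite -mulr_sumr pmulr_lge0 // lt_neqAle sumr_ge0 => [|i _]; last exact: sqr_ge0.
rewrite andbT eq_sym; apply: contra_neq v0 => v0.
apply/rowP => i; rewrite mxE.
by apply/eqP; rewrite -sqrf_eq0; apply/eqP; apply: (psumr_eq0P _ v0) => // j _; exact: sqr_ge0.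
Qed.

Lemma unitary_dot {C : numClosedFieldType} {n : nat} (P : 'M[C]_n) (x y : 'cV[C]_n) :
  P \is unitarymx ->
  \sum_k ((P *m x) k 0)^* * (P *m y) k 0 = \sum_k (x k 0)^* * y k 0.
Proof.
move=> PU; have dotE (u v : 'cV[C]_n) :
    \sum_k (u k 0)^* * v k 0 = (u^t* *m v) 0 0.
  by rewrite mxE; apply: eq_bigr => k _; rewrite !mxE.
rewrite !dotE trmx_mul map_mxM -mulmxA (mulmxA (P^t*)).
by rewrite -invmx_unitary // mulVmx ?unitarymx_unit // mul1mx.
Qed.

Lemma unitary_sqnorm {C : numClosedFieldType} {n : nat} (P : 'M[C]_n) (x : 'cV[C]_n) :
  P \is unitarymx -> \sum_k `|(P *m x) k 0| ^+ 2 = \sum_k `|x k 0| ^+ 2.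
Proof.
move=> PU; have e := unitary_dot P x x PU.
under eq_bigr do rewrite normCKC.
by rewrite e; apply: eq_bigr => k _; rewrite normCKC.
Qed.

Lemma sqnormC {R : realType} {n : nat} (x : 'cV[R]_n) :
  real_complex R (sqnorm x) = \sum_k `|(map_mx (real_complex R) x) k 0| ^+ 2.
Proof.
rewrite rmorph_sum; apply: eq_bigr => k _; rewrite mxE /= real_normK ?rmorphXn //.
by apply/complex_realP; exists (x k 0).
Qed.

(** The formula of [lambda_bar] for an arbitrary list; on a sorted spectrum, starting at index 1
    discards one copy of the smallest eigenvalue. *)
Definition nontrivial_radius {R : realType} (s : seq R) : R :=
  Num.max `|1 - nth 0 s 1| `|1 - last 0 s|.

(** In an eigenbasis [1 - A] multiplies coordinate [k] by [1 - d k]. This factor is within the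
    radius unless [d k] is a simple smallest eigenvalue; then [k] is the direction of [u], where [y]
    has no component. *)
Lemma sym_gap_bound {R : realType} {n : nat} (A : 'M[R]_n) (u y : 'cV[R]_n) :
  A^T = A -> (forall x : 'cV[R]_n, 0 <= dotv x (A *m x)) ->
  u != 0 -> A *m u = 0 -> dotv u y = 0 ->
  sqnorm (y - A *m y) <= nontrivial_radius (spectrum A) ^+ 2 * sqnorm y.
Proof.
move=> symA psd u0 Au uy.
have [P [d [PU eA spA]]] := symmetric_diagonalization symA.
set D := diag_mx _ in eA.
pose cx n := map_mx (real_complex R) : 'cV[R]_n -> 'cV[R[i]]_n.
pose z := P *m cx n y; pose v := P *m cx n u.
have ss := sorted_spectrum _ _ A; set sp := spectrum A in spA ss *.
have d_sp k : d k \in sp.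
  by rewrite (perm_mem spA); apply/mapP; exists k; rewrite ?mem_enum.
have d_ge0 k : 0 <= d k by apply: (@spectrum_ge0 _ _ A); rewrite ?symA.
have d_last k : d k <= last 0 sp by exact: le_last.
have PV : P *m P^t* = 1%:M by exact/unitarymxP.
(* The kernel vector [u] only has coordinates along eigenvalues equal to 0. *)
have dv k : d k = 0 \/ v k 0 = 0.
  have : D *m v = 0.
    rewrite -[D *m v]mul1mx -PV -!mulmxA (mulmxA D) (mulmxA (P^t*)) (mulmxA (P^t*)) -eA.
    by rewrite -map_mxM Au map_mx0 mulmx0.
  move=> /matrixP/(_ k 0); rewrite mul_diag_mx !mxE => /eqP.
  rewrite mulf_eq0 => /orP[/eqP h|/eqP ->]; [left|by right].
  exact: complexI.
have key k : z k 0 = 0 \/ `|1 - d k| <= nontrivial_radius sp.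
  suff [|le1] : z k 0 = 0 \/ nth 0 sp 1 <= d k; [by left| |].
    right; rewrite /nontrivial_radius le_max.
    have := d_last k; have := d_ge0 k.
    (* Below 1 the distance from 1 is controlled by the eigenvalue at index 1, above 1 by the last
       eigenvalue. *)
    move=> dk0 dl; have [h|h] := leP (d k) 1; apply/orP; [left|right].
      by rewrite !ger0_norm ?subr_ge0 ?(le_trans le1) // lerD2l lerN2.
    have h' := le_trans (ltW h) dl.
    by rewrite !ler0_norm ?subr_le0 ?(ltW h) // lerN2 lerD2l lerN2.
  (* If no other eigenvalue is at most d k >= 0, then no other one vanishes, so
     v is supported at k and orthogonality to v forces z k = 0. *)
  have [/existsP[j /andP[jk djk]]|/existsPn no] :=
    boolP [exists j, (j != k) && (d j <= d k)].
    (* The distinct indices [j] and [k] provide two entries at most [d k], counted with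
       multiplicity. *)
    right; apply: nth1_sorted_le => //; rewrite (permP spA) count_map enumT -size_filter.
    rewrite (_ : [seq _ <- _ | _] = enum [pred i | d i <= d k]); last first.
      by rewrite /enum_mem; apply: eq_filter.
    rewrite -cardE; apply: leq_trans (_ : #|[set j; k]| <= _)%N; first by rewrite cards2 jk.
    by apply/subset_leq_card/subsetP => i; rewrite !inE => /orP[]/eqP->.
  have vj j : j != k -> v j 0 = 0.
    move=> jk; have [dj|//] := dv j.
    by have := no j; rewrite jk dj d_ge0.
  left; have vk0 : v k 0 != 0.
    apply: contra_neq u0 => vk0; suff vz : v = 0.
      have : P^t* *m v = 0 by rewrite vz mulmx0.
      rewrite mulmxA -invmx_unitary // mulVmx ?unitarymx_unit // mul1mx => /matrixP uz.
      by apply/matrixP => i j; have := uz i j; rewrite !mxE => /complexI.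
    by apply/matrixP => i j; rewrite ord1 [RHS]mxE; have [->//|/vj] := eqVneq i k.
  have := unitary_dot P (cx n u) (cx n y) PU.
  rewrite (bigD1 k) //= big1 ?addr0 => [e|j jk]; last by rewrite vj // conjC0 mul0r.
  apply/eqP; suff : (v k 0)^* * z k 0 == 0 by rewrite mulf_eq0 conjC_eq0 (negPf vk0).
  rewrite e; suff -> : \sum_j ((cx n u) j 0)^* * (cx n y) j 0 = real_complex R (dotv u y).
    by rewrite uy.
  rewrite rmorph_sum; apply: eq_bigr => j _; rewrite !mxE rmorphM /= conj_Creal //.
  by apply/complex_realP; exists (u j 0).
(* Over [R[i]] both norms are invariant under the unitary change of basis, so the bound may be
   checked coordinate by coordinate. *)
rewrite -lecR rmorphM /= !sqnormC.
have -> : map_mx (real_complex R) (y - A *m y) = P^t* *m (z - D *m z).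
  rewrite map_mxB map_mxM /= eA mulmxBr /z !mulmxA; congr (_ - _).
  by rewrite -[P^t*]invmx_unitary // mulVmx ?unitarymx_unit // mul1mx.
rewrite unitary_sqnorm ?trmxC_unitary // -(unitary_sqnorm P (cx n y) PU) -/z mulr_sumr.
apply: ler_sum => k _.
have -> : (z - D *m z) k 0 = real_complex R (1 - d k) * z k 0.
  by rewrite mul_diag_mx !mxE rmorphB rmorph1 mulrBl mul1r.
have [->|dk] := key k; first by rewrite !mulr0 normr0 expr0n mulr0.
rewrite normrM exprMn ler_wpM2r ?exprn_ge0 //.
rewrite real_normK; last by apply/complex_realP; exists (1 - d k).
rewrite -rmorphXn /= lecR -real_normK ?num_real // lerXn2r ?nnegrE //.
exact: le_trans (normr_ge0 _) dk.
Qed.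

(** Cauchy-Schwarz: [b * (a * b - c ^+ 2)] is the sum of the squares of the coordinates of
    [b x - c y]. If [b = 0] then [y = 0], and that case is treated apart. *)
Lemma dotv_le {R : realType} {n : nat} (x y : 'cV[R]_n) :
  dotv x y ^+ 2 <= sqnorm x * sqnorm y.
Proof.
set a := sqnorm x; set b := sqnorm y; set c := dotv x y.
have b0 : 0 <= b by apply: sumr_ge0 => i _; exact: sqr_ge0.
have : 0 <= b * (a * b - c ^+ 2).
  have -> : b * (a * b - c ^+ 2) = \sum_i (b * x i 0 - c * y i 0) ^+ 2.
    transitivity (\sum_i (b ^+ 2 * x i 0 ^+ 2 - (b * c *+ 2) * (x i 0 * y i 0)
        + c ^+ 2 * y i 0 ^+ 2)); last by apply: eq_bigr => i _; ring.
    rewrite big_split sumrB -!mulr_sumr -/(sqnorm x) -/(sqnorm y) -/(dotv x y) -/a -/b -/c /=.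
    ring.
  by apply: sumr_ge0 => i _; exact: sqr_ge0.
have [b_eq0 _|bN0] := eqVneq b 0.
  rewrite b_eq0 mulr0 (_ : c = 0) ?expr0n // /c /dotv big1 // => i _.
  suff /eqP : y i 0 ^+ 2 = 0 by rewrite sqrf_eq0 => /eqP->; rewrite mulr0.
  by apply: (psumr_eq0P _ b_eq0) => // j _; exact: sqr_ge0.
by rewrite pmulr_rge0 ?subr_ge0 // lt_neqAle eq_sym bN0.
Qed.

(** * Expander mixing for weighted graphs with positive degrees *)

Definition normalized_laplacian {R : realType} {n : nat} (W : 'M[R]_n) : 'M[R]_n :=
  1%:M - diag_mx (\row_i (Num.sqrt (\sum_j W i j))^-1) *m W
           *m diag_mx (\row_i (Num.sqrt (\sum_j W i j))^-1).

Section WeightedGraph.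
Variables (R : realType) (n : nat) (W : 'M[R]_n).
Hypotheses (symW : W^T = W) (W_ge0 : forall i j, 0 <= W i j).
Let dg i := \sum_j W i j.
Hypothesis dg_gt0 : forall i, 0 < dg i.
(** Multiplication by [D^{1/2}]: it turns the degree-weighted inner product of functions on vertices
    into the Euclidean one. *)
Let lift (a : 'I_n -> R) : 'cV[R]_n := \col_i (Num.sqrt (dg i) * a i).
Let form (a b : 'I_n -> R) := \sum_i \sum_j W i j * (a i * b j).
Let L := normalized_laplacian W.

Let sqrt_dg i : Num.sqrt (dg i) ^+ 2 = dg i.
Proof. by rewrite sqr_sqrtr // ltW. Qed.

Let sqrt_dg_neq0 i : Num.sqrt (dg i) != 0.
Proof. by rewrite gt_eqF // sqrtr_gt0. Qed.

Let WC i j : W i j = W j i.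
Proof. by rewrite -{1}symW mxE. Qed.

Lemma dotv_lift a b : dotv (lift a) (lift b) = \sum_i dg i * (a i * b i).
Proof. by apply: eq_bigr => i _; rewrite !mxE mulrACA -expr2 sqrt_dg. Qed.

Lemma lift_walk a i :
  (lift a - L *m lift a) i 0 = (\sum_j W i j * a j) / Num.sqrt (dg i).
Proof.
rewrite /L /normalized_laplacian mulmxBl mul1mx opprB addrC subrK.
rewrite -!mulmxA mul_diag_mx mxE mxE mulrC; congr (_ / _).
rewrite mul_diag_mx mxE; apply: eq_bigr => j _; rewrite !mxE mulrA mulrA.
by rewrite divfK ?sqrt_dg_neq0.
Qed.

(** Since [1 - L] is [D^{-1/2} W D^{-1/2}], the square roots introduced by [lift] cancel on both
    sides. *)
Lemma dotv_walk a b : dotv (lift a) (lift b - L *m lift b) = form a b.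
Proof.
apply: eq_bigr => i _; rewrite lift_walk mxE mulrC mulrA divfK ?sqrt_dg_neq0 //.
by rewrite mulr_suml; apply: eq_bigr => j _; ring.
Qed.

Lemma lift_surj (x : 'cV[R]_n) : x = lift (fun i => x i 0 / Num.sqrt (dg i)).
Proof.
by apply/matrixP => i j; rewrite ord1 mxE mulrC divfK ?sqrt_dg_neq0.
Qed.

(** The quadratic form of [L] is the Dirichlet form, half the sum of [W i j * (a i - a j) ^+ 2];
    symmetry of [W] lets the diagonal part be split evenly between [a i ^+ 2] and [a j ^+ 2]. *)
Lemma normalized_laplacian_psd (x : 'cV[R]_n) : 0 <= dotv x (L *m x).
Proof.
rewrite (lift_surj x); set a := fun i => _.
have -> : dotv (lift a) (L *m lift a) = \sum_i dg i * (a i * a i) - form a a.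
  rewrite -dotv_lift -dotv_walk /dotv -sumrB; apply: eq_bigr => i _.
  by rewrite !mxE; ring.
have -> : \sum_i dg i * (a i * a i) - form a a =
    2^-1 * \sum_i \sum_j W i j * (a i - a j) ^+ 2.
  have eS : \sum_i dg i * (a i * a i) = \sum_i \sum_j W i j * a i ^+ 2.
    by apply: eq_bigr => i _; rewrite mulr_suml; apply: eq_bigr => j _; ring.
  have eS' : \sum_i dg i * (a i * a i) = \sum_i \sum_j W i j * a j ^+ 2.
    by rewrite eS exchange_big; apply: eq_bigr => i _; apply: eq_bigr => j _; rewrite WC.
  transitivity (2^-1 * \sum_i \sum_j (W i j * a i ^+ 2 + W i j * a j ^+ 2
      - 2 * (W i j * (a i * a j)))); last first.
    by congr (_ * _); apply: eq_bigr => i _; apply: eq_bigr => j _; ring.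
  under [in RHS]eq_bigr => i _ do rewrite sumrB big_split -mulr_sumr /=.
  rewrite sumrB big_split /= -eS -eS' -mulr_sumr -/(form a a); by field.
apply: mulr_ge0; first by rewrite invr_ge0.
apply: sumr_ge0 => i _; apply: sumr_ge0 => j _.
by rewrite mulr_ge0 ?sqr_ge0.
Qed.

Lemma normalized_laplacian_sym : L^T = L.
Proof.
by rewrite /L /normalized_laplacian linearB /= trmx1 !trmx_mul !tr_diag_mx symW mulmxA.
Qed.

(** The row sums of [W] are the degrees, so [1 - L] fixes [D^{1/2}] applied to the constant
    function. *)
Lemma normalized_laplacian_ker : L *m lift (fun=> 1) = 0.
Proof.
rewrite -[LHS](subKr (lift (fun=> 1))); apply/eqP; rewrite subr_eq0 eq_sym.
apply/eqP/matrixP => i j; rewrite ord1 lift_walk mxE mulr1.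
apply: (mulIf (sqrt_dg_neq0 i)); rewrite divfK // -expr2 sqrt_dg.
by apply: eq_bigr => k _; rewrite mulr1.
Qed.

Let total := \sum_i dg i.

Definition mean (a : 'I_n -> R) := (\sum_i dg i * a i) / total.

(** The left side is [total] times the variance for the degree measure; values in [[0, 1]] satisfy
    [a i ^+ 2 <= a i]. *)
Lemma centered_sqnorm a : 0 < total -> (forall i, 0 <= a i <= 1) ->
  sqnorm (lift (fun i => a i - mean a)) <= total * (mean a * (1 - mean a)).
Proof.
move=> t0 a01.
have -> : sqnorm (lift (fun i => a i - mean a))
   = \sum_i dg i * a i ^+ 2 - total * mean a ^+ 2.
  have e : \sum_i dg i * a i = total * mean a by rewrite mulrC divfK ?gt_eqF.
  transitivity (\sum_i (dg i * a i ^+ 2 - 2 * mean a * (dg i * a i) + mean a ^+ 2 * dg i)).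
    by apply: eq_bigr => i _; rewrite mxE exprMn sqrt_dg; ring.
  by rewrite big_split sumrB -!mulr_sumr e -/total /=; ring.
have -> : total * (mean a * (1 - mean a)) = \sum_i dg i * a i - total * mean a ^+ 2.
  by rewrite [\sum_i _](_ : _ = total * mean a); [ring | rewrite mulrC divfK ?gt_eqF].
rewrite lerD2r; apply: ler_sum => i _; rewrite ler_wpM2l ?(ltW (dg_gt0 i)) //.
by have /andP[h0 h1] := a01 i; rewrite expr2 ler_piMr.
Qed.

(** Centering both functions subtracts exactly [total * (mean a * mean b)] from the form.
    Cauchy-Schwarz then pairs [lift a'] with [(1 - L) lift b'], whose norm the gap bound controls
    because [b'] has mean zero. *)
Lemma weighted_mixing a b :
  0 < total -> (forall i, 0 <= a i <= 1) -> (forall i, 0 <= b i <= 1) ->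
  `|form a b / total - mean a * mean b| <=
    nontrivial_radius (spectrum L) *
      Num.sqrt (mean a * mean b * (1 - mean a) * (1 - mean b)).
Proof.
move=> t0 a01 b01; set rho := nontrivial_radius _.
pose a' i := a i - mean a; pose b' i := b i - mean b.
have ea : \sum_i dg i * a i = total * mean a by rewrite mulrC divfK ?gt_eqF.
have eb : \sum_i dg i * b i = total * mean b by rewrite mulrC divfK ?gt_eqF.
have rho0 : 0 <= rho by rewrite /rho /nontrivial_radius le_max normr_ge0.
have t_neq0 : total != 0 by rewrite gt_eqF.
have form_centered : form a' b' = form a b - total * (mean a * mean b).
  transitivity (\sum_i \sum_j (W i j * (a i * b j) - mean b * (W i j * a i)
      - mean a * (W i j * b j) + mean a * mean b * W i j)).
    by apply: eq_bigr => i _; apply: eq_bigr => j _; rewrite /a' /b'; ring.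
  under eq_bigr => i _ do rewrite big_split !sumrB -!mulr_sumr -mulr_suml -/(dg i).
  rewrite big_split !sumrB -!mulr_sumr /= ea -/total -/(form a b).
  (* By symmetry the column sums of [W] are the degrees as well. *)
  rewrite exchange_big [\sum_j \sum_i _](_ : _ = total * mean b); first by ring.
  rewrite -eb; apply: eq_bigr => j _; rewrite -mulr_suml; congr (_ * _).
  by apply: eq_bigr => i _; rewrite WC.
have u_neq0 : lift (fun=> 1) != 0.
  apply: contra_neq t_neq0 => /matrixP u0; rewrite /total big1 // => i _.
  by rewrite -[LHS]sqrt_dg; have := u0 i 0; rewrite !mxE mulr1 => ->; rewrite expr0n.
have ub : dotv (lift (fun=> 1)) (lift b') = 0.
  rewrite dotv_lift; under eq_bigr do rewrite mul1r mulrBr.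
  by rewrite sumrB -mulr_suml eb subrr.
have := sym_gap_bound L (lift (fun=> 1)) (lift b') normalized_laplacian_sym
  normalized_laplacian_psd u_neq0 normalized_laplacian_ker ub.
have := dotv_le (lift a') (lift b' - L *m lift b').
rewrite dotv_walk form_centered -/rho => CS gap.
have na := centered_sqnorm a t0 a01; have nb := centered_sqnorm b t0 b01.
have sq_ge0 (x : 'cV[R]_n) : 0 <= sqnorm x by apply: sumr_ge0 => i _; exact: sqr_ge0.
have -> : form a b / total - mean a * mean b =
    (form a b - total * (mean a * mean b)) / total.
  by field.
(* Squaring away the root requires a nonnegative radicand; each factor [m * (1 - m)] is nonnegative
   because [total] times it bounds a squared norm. *)
have q_ge0 : 0 <= mean a * mean b * (1 - mean a) * (1 - mean b).
  have pa : 0 <= mean a * (1 - mean a).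
    by rewrite -(pmulr_rge0 _ t0); exact: le_trans (sq_ge0 _) na.
  have pb : 0 <= mean b * (1 - mean b).
    by rewrite -(pmulr_rge0 _ t0); exact: le_trans (sq_ge0 _) nb.
  by have := mulr_ge0 pa pb; rewrite mulrACA mulrA.
rewrite -ler_sqr ?nnegrE ?mulr_ge0 ?sqrtr_ge0 // real_normK ?num_real //.
rewrite !exprMn sqr_sqrtr // exprVn ler_pdivrMr ?exprn_gt0 //.
apply: le_trans CS _.
apply: le_trans (ler_pM (sq_ge0 _) (sq_ge0 _) na gap) _.
apply: (@le_trans _ _ (total * (mean a * (1 - mean a)) *
  (rho ^+ 2 * (total * (mean b * (1 - mean b)))))).
  apply: ler_wpM2l; first exact: le_trans (sq_ge0 _) na.
  by apply: ler_wpM2l; rewrite ?sqr_ge0.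
by rewrite le_eqVlt; apply/orP; left; apply/eqP; ring.
Qed.

End WeightedGraph.

(** * Double counting in the hypergraph *)

Definition codeg {V : finType} (H : {set {set V}}) (x y : {set V}) : nat :=
  if [disjoint x & y] then #|[set F in H | x :|: y \subset F]| else 0%N.

(** For a family [T] of [t]-sets and an [s]-set [y], division by ['C(s, t)] gives the average of the
    indicator of [T] over the [t]-subsets of [y]. *)
Definition subcount {V : finType} (T : {set {set V}}) (y : {set V}) : nat :=
  #|[set z in T | z \subset y]|.

Lemma card_support_fiber (V : finType) (s : nat) (A : {set V}) :
  A \in ksubsets V s -> #|[pred x : dtuple V s | support_set x == A]| = s`!.
Proof.
rewrite inE => /eqP cA.
have -> : s`! = #|A| ^_ s by rewrite cA ffactnn.
rewrite -(card_imset _ val_inj) -card_uniq_tuples.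
apply: eq_card => t; rewrite !inE; apply/imsetP/andP => [[x + ->]|[tA ut]].
  move=> /eqP <-; split; last exact: (valP x).
  by apply/allP => v vx; change (v \in support_set x); rewrite inE.
exists (Sub t ut : dtuple V s) => //; rewrite inE eqEcard; apply/andP; split.
  by apply/subsetP => v; rewrite inE => /(allP tA).
by rewrite /support_set cardsE cA (card_uniqP ut) size_tuple.
Qed.

(** Each [s]-set is the support of [s!] tuples; this moves sums over the vertices of the tuple graph
    to sums over sets. *)
Lemma sum_dtuple (R : realType) (V : finType) (s : nat) (phi : {set V} -> R) :
  \sum_(i < #|{: dtuple V s}|) phi (support_set (enum_val i)) =
    s`!%:R * \sum_(x in ksubsets V s) phi x.
Proof.
rewrite -(big_enum_val (fun x => phi (support_set x))) /=.
rewrite (partition_big (@support_set V s) (mem (ksubsets V s))) /= => [|x _]; last first.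
  by rewrite inE cardsE (card_uniqP (valP x)) size_tuple.
rewrite mulr_sumr; apply: eq_bigr => A hA.
rewrite (eq_bigr (fun=> phi A)) => [|x /eqP-> //].
rewrite sumr_const mulr_natl -(card_support_fiber V s A hA).
by congr (_ *+ _); apply: eq_card.
Qed.

(** Removing [Z] is a bijection onto the subsets of [F :\: Z] of size [s - #|Z|]. *)
Lemma card_subsets_between (V : finType) (Z F : {set V}) (s : nat) :
  Z \subset F -> (#|Z| <= s)%N ->
  #|[set y : {set V} | [&& y \in ksubsets V s, Z \subset y & y \subset F]]| =
    'C(#|F| - #|Z|, s - #|Z|).
Proof.
move=> ZF Zs.
pose B := [set D : {set V} | D \subset F :\: Z & #|D| == (s - #|Z|)%N].
have injU : {in B &, injective (fun D => D :|: Z)}.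
  move=> D1 D2; rewrite !inE !subsetD => /andP[/andP[_ d1] _] /andP[/andP[_ d2] _].
  move=> /(congr1 (fun X => X :\: Z)).
  by rewrite !setDUl setDv !setU0 (setDidPl d1) (setDidPl d2).
have -> : (#|F| - #|Z|)%N = #|F :\: Z| by rewrite cardsD (setIidPr ZF).
rewrite -cards_draws -/B -(card_in_imset injU).
apply: eq_card => y; rewrite !inE; apply/and3P/imsetP => [[/eqP cy Zy yF]|[D]].
  exists (y :\: Z); last first.
    apply/setP => v; rewrite !inE.
    by case: (boolP (v \in Z)) => [/(subsetP Zy)->|_]; rewrite ?orbT ?orbF.
  rewrite inE setSD //= cardsD (setIidPr Zy) cy eqxx //.
rewrite inE subsetD => /andP[/andP[DF DZ] /eqP cD] ->.
rewrite cardsU disjoint_setI0 // cards0 subn0 cD subnK // eqxx subsetUr.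
by rewrite subUset DF.
Qed.

(** Writing the condition as [y \subset F :\: x] absorbs disjointness and makes the count additive
    over edges. *)
Lemma codegE (V : finType) (H : {set {set V}}) (x y : {set V}) :
  codeg H x y = (\sum_(F in H | x \subset F) (y \subset F :\: x))%N.
Proof.
rewrite /codeg; have [xy|xy] := boolP [disjoint x & y].
  rewrite -sum1_card big_mkcond [RHS]big_mkcond; apply: eq_bigr => F _.
  rewrite !inE subUset subsetD (disjoint_sym y) xy andbT.
  by case: (F \in H) => //; case: (x \subset F) => //; case: (y \subset F).
by rewrite big1 // => F _; rewrite subsetD (disjoint_sym y) (negPf xy) andbF.
Qed.

Lemma codegC (V : finType) (H : {set {set V}}) (x y : {set V}) :
  codeg H x y = codeg H y x.
Proof. by rewrite /codeg disjoint_sym setUC. Qed.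

Lemma codeg0 (V : finType) (H : {set {set V}}) (y : {set V}) :
  codeg H set0 y = deg H y.
Proof. by rewrite /codeg disjoints_subset sub0set; apply: eq_card => F; rewrite !inE set0U. Qed.

Lemma card_edges_between (V : finType) (H S T : {set {set V}}) :
  #|edges_between H S T| = (\sum_(x in S) \sum_(z in T) codeg H x z)%N.
Proof.
rewrite pair_big_dep /= -sum1_card.
rewrite (partition_big fst (fun p => (p.1 \in S) && (p.2 \in T))) /= => [|p]; last first.
  by rewrite inE => /and5P[-> ->].
apply: eq_bigr => -[x z] /= /andP[xS zT]; rewrite /codeg sum1dep_card.
have [xz|xz] := boolP [disjoint x & z]; last first.
  apply/eqP; rewrite cards_eq0; apply/eqP/setP => -[[x' z'] F]; rewrite !inE /=.
  by apply/negP => /andP[/and5P[_ _ d _ _] /eqP[e1 e2]]; move: xz; rewrite -e1 -e2 d.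
have inj : injective (fun F : {set V} => (x, z, F)) by move=> F1 F2 [].
rewrite -(card_imset _ inj).
apply: eq_card => -[[x' z'] F]; rewrite !inE /=; apply/andP/imsetP.
  move=> [/and5P[_ _ _ FH sF] /eqP[e1 e2]]; rewrite e1 e2 in sF *.
  by exists F; rewrite // inE FH.
by move=> [F']; rewrite inE => /andP[FH sF] [-> -> ->]; rewrite xS zT xz FH sF eqxx.
Qed.

(** Both sides count chains [z \subset y \subset F :\: x] with [F] an edge containing [x]: once [F]
    and [z] are fixed, the binomial counts the choices of [y]. The cases [T = [set set0]] and
    [x = set0] give the degree and volume identities below. *)
Lemma sum_codeg_subcount (V : finType) (r s t : nat) (H T : {set {set V}}) (x : {set V}) :
  (t <= s)%N -> uniform r H -> T \subset ksubsets V t ->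
  (\sum_(y in ksubsets V s) codeg H x y * subcount T y =
    'C(r - #|x| - t, s - t) * \sum_(z in T) codeg H x z)%N.
Proof.
move=> ts uH /subsetP hT.
pose ind (F z y : {set V}) : nat := ((z \subset y) && (y \subset F :\: x)).
transitivity (\sum_(F in H | x \subset F) \sum_(z in T) \sum_(y in ksubsets V s) ind F z y)%N.
  have subcountE y : subcount T y = (\sum_(z in T) (z \subset y))%N.
    rewrite /subcount -sum1dep_card big_mkcondr; apply: eq_bigr => z _.
    by case: (z \subset y).
  under eq_bigr => y _ do rewrite codegE subcountE big_distrlr /=.
  rewrite exchange_big; apply: eq_bigr => F _; rewrite exchange_big.
  by apply: eq_bigr => z _; apply: eq_bigr => y _; rewrite mulnb andbC.
rewrite big_distrr /=; under [RHS]eq_bigr => z _ do rewrite codegE big_distrr /=.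
rewrite [RHS]exchange_big /=; apply: eq_bigr => F /andP[FH xF]; apply: eq_bigr => z zT.
have cz : #|z| = t by have := hT z zT; rewrite inE => /eqP.
have [zF|zF] := boolP (z \subset F :\: x); last first.
  rewrite muln0 big1 // => y _; rewrite /ind.
  have [zy|//] := boolP (z \subset y); case: (boolP (y \subset _)) => //.
  by move=> /(subset_trans zy); rewrite (negPf zF).
have -> : (r - #|x|)%N = #|F :\: x| by rewrite cardsD (setIidPr xF) (uH F FH).
rewrite muln1 -cz -card_subsets_between ?cz // -sum1_card big_mkcond [RHS]big_mkcond.
apply: eq_bigr => y _; rewrite [in RHS]inE /ind; case: (y \in _) => //=.
Qed.

Lemma subcount_ksubsets (V : finType) (s t : nat) (y : {set V}) :
  y \in ksubsets V s -> subcount (ksubsets V t) y = 'C(s, t).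
Proof.
rewrite inE => /eqP <-; rewrite -cards_draws.
by apply: eq_card => z; rewrite !inE andbC.
Qed.

Lemma subcount_subset (V : finType) (T U : {set {set V}}) (y : {set V}) :
  T \subset U -> (subcount T y <= subcount U y)%N.
Proof.
move=> /subsetP TU; apply/subset_leq_card/subsetP => z; rewrite !inE.
by case/andP => /TU -> ->.
Qed.

Lemma sum_codeg (V : finType) (r s : nat) (H : {set {set V}}) (x : {set V}) :
  uniform r H ->
  (\sum_(y in ksubsets V s) codeg H x y = 'C(r - #|x|, s) * deg H x)%N.
Proof.
move=> uH; have := sum_codeg_subcount V r s 0 H [set set0] x (leq0n s) uH.
rewrite big_set1 codegC codeg0 !subn0 => <-.
  apply: eq_bigr => y _; rewrite /subcount.
  rewrite (_ : [set z in _ | _] = [set set0]) ?cards1 ?muln1 //.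
  by apply/setP => z; rewrite !inE; case: eqP => // ->; rewrite sub0set.
by apply/subsetP => z; rewrite !inE => /eqP->; rewrite cards0.
Qed.

Lemma sum_deg_subcount (V : finType) (r s t : nat) (H T : {set {set V}}) :
  (t <= s)%N -> uniform r H -> T \subset ksubsets V t ->
  (\sum_(y in ksubsets V s) deg H y * subcount T y = 'C(r - t, s - t) * vol H T)%N.
Proof.
move=> ts uH hT; have := sum_codeg_subcount V r s t H T set0 ts uH hT.
rewrite cards0 subn0 /vol => e.
under eq_bigr do rewrite -codeg0; rewrite e.
by congr (_ * _)%N; apply: eq_bigr => z _; rewrite codeg0.
Qed.

Lemma vol_setD (V : finType) (H S U : {set {set V}}) :
  S \subset U -> (vol H S + vol H (U :\: S) = vol H U)%N.
Proof.
by move=> SU; rewrite /vol [RHS](big_setID S) /= (setIidPr SU).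
Qed.

Lemma density_setD (R : realType) (V : finType) (H S : {set {set V}}) (j : nat) :
  S \subset ksubsets V j -> vol H (ksubsets V j) != 0%N ->
  density R H j (ksubsets V j :\: S) = 1 - density R H j S.
Proof.
move=> hS v0; have vR : (vol H (ksubsets V j))%:R != 0 :> R by rewrite pnatr_eq0.
apply/eqP; rewrite eq_sym subr_eq addrC; apply/eqP.
by rewrite /density -mulrDl -natrD vol_setD // mulfV.
Qed.

(** * Application to the graph on ordered [s]-tuples *)

Theorem theorem15 (R : realType) (V : finType) (r s t : nat)
    (H : {set {set V}})
    (ht : (1 <= t)%N) (hts : (t <= s)%N) (hsr : (2 * s <= r)%N)
    (hrn : (r <= #|V|)%N)
    (hH : uniform r H)
    (hcov : forall x : {set V}, x \in ksubsets V s ->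
      exists2 F : {set V}, F \in H & x \subset F)
    (S T : {set {set V}})
    (hS : S \subset ksubsets V s) (hT : T \subset ksubsets V t) :
  `| edge_density R H s t S T - density R H s S * density R H t T |
    <= lambda_bar R H s *
       Num.sqrt (density R H s S * density R H t T
                 * density R H s (ksubsets V s :\: S)
                 * density R H t (ksubsets V t :\: T)).
Proof.
(* Together with [t <= s], this makes positive all the binomials that are cancelled later. *)
have sr : (s <= r - s)%N by lia.
have cst : (0 < 'C(s, t))%N by rewrite bin_gt0.
have crs : (0 < 'C(r - s, s))%N by rewrite bin_gt0.
have crt : (0 < 'C(r - t, s - t))%N by rewrite bin_gt0; lia.
have crst : (0 < 'C(r - s - t, s - t))%N by rewrite bin_gt0; lia.
have deg_gt0 x : x \in ksubsets V s -> (0 < deg H x)%N.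
  by move=> /hcov[F FH xF]; apply/card_gt0P; exists F; rewrite inE FH.
have vols_gt0 : (0 < vol H (ksubsets V s))%N.
  have /card_gt0P[x xs] : (0 < #|ksubsets V s|)%N.
    by rewrite card_draws bin_gt0; lia.
  by rewrite /vol (bigD1 x) //= ltn_addr // deg_gt0.
(* With [T] all [t]-sets, every [s]-set has subcount ['C(s, t)]; the resulting relation between the
   two total volumes also yields positivity of the second. *)
have volst : ('C(r - t, s - t) * vol H (ksubsets V t) = vol H (ksubsets V s) * 'C(s, t))%N.
  rewrite -(sum_deg_subcount _ _ _ _ _ _ hts hH (subxx _)) /vol big_distrl /=.
  by apply: eq_bigr => y ys; rewrite (subcount_ksubsets _ s).
have volt_gt0 : (0 < vol H (ksubsets V t))%N.
  move: (muln_gt0 (vol H (ksubsets V s)) 'C(s, t)); rewrite -volst muln_gt0 vols_gt0 cst.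
  by case/andP.
have edges_sub : ('C(r - s - t, s - t) * #|edges_between H S T| =
    \sum_(x in S) \sum_(y in ksubsets V s) codeg H x y * subcount T y)%N.
  rewrite card_edges_between big_distrr; apply: eq_bigr => x xS /=.
  have := subsetP hS x xS; rewrite inE => /eqP cx.
  by rewrite (sum_codeg_subcount _ r s t) // cx.
(* For all [t]-sets the subcount is constant, so the weighted sum also equals ['C(s, t)] times a
   plain sum of codegrees. *)
have edges_full : ('C(r - s - t, s - t) * #|edges_between H (ksubsets V s) (ksubsets V t)| =
    'C(r - s, s) * vol H (ksubsets V s) * 'C(s, t))%N.
  rewrite card_edges_between big_distrr /= /vol big_distrr big_distrl /=.
  apply: eq_bigr => x xs; have := xs; rewrite inE => /eqP cx.
  have sc := sum_codeg V r s H x hH.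
  have sct := sum_codeg_subcount V r s t H (ksubsets V t) x hts hH (subxx _).
  rewrite cx in sc sct; rewrite -sc -sct big_distrl /=.
  by apply: eq_bigr => y ys; rewrite (subcount_ksubsets _ s).
pose supp (i : 'I_#|{: dtuple V s}|) := support_set (enum_val i).
have supp_s i : supp i \in ksubsets V s.
  by rewrite inE cardsE (card_uniqP (valP (enum_val i))) size_tuple.
pose W := adjacency R H s.
(* [weight] depends only on the supports and unfolds to [codeg]. *)
have WE i j : W i j = (codeg H (supp i) (supp j))%:R by rewrite mxE.
have symW : W^T = W by apply/matrixP => i j; rewrite mxE !WE codegC.
have W_ge0 i j : 0 <= W i j by rewrite WE ler0n.
(* There are ['C(r - s, s)] neighbouring sets inside each edge around [supp i], and each has [s!]
   orderings. *)
have dgE i : \sum_j W i j = s`!%:R * 'C(r - s, s)%:R * (deg H (supp i))%:R.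
  under eq_bigr do rewrite WE.
  rewrite (sum_dtuple _ _ _ (fun y => (codeg H (supp i) y)%:R)) -natr_sum (sum_codeg _ r) //.
  by have := supp_s i; rewrite inE => /eqP ->; rewrite natrM mulrA.
have dg_gt0 i : 0 < \sum_j W i j.
  by rewrite dgE !mulr_gt0 ?ltr0n ?fact_gt0 ?deg_gt0.
have sum_dg (phi : {set V} -> R) : \sum_i (\sum_j W i j) * phi (supp i) =
    s`!%:R ^+ 2 * 'C(r - s, s)%:R * \sum_(x in ksubsets V s) (deg H x)%:R * phi x.
  under eq_bigr do rewrite dgE -mulrA.
  rewrite -mulr_sumr (sum_dtuple _ _ _ (fun x => (deg H x)%:R * phi x)).
  by ring.
have total : \sum_i \sum_j W i j =
    s`!%:R ^+ 2 * 'C(r - s, s)%:R * (vol H (ksubsets V s))%:R.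
  have := sum_dg (fun=> 1); under eq_bigr do rewrite mulr1; move=> ->.
  by congr (_ * _); rewrite natr_sum; apply: eq_bigr => x _; rewrite mulr1.
pose a (x : {set V}) : R := (x \in S)%:R.
pose b (y : {set V}) : R := (subcount T y)%:R / 'C(s, t)%:R.
have nz n : (0 < n)%N -> n%:R != 0 :> R by rewrite pnatr_eq0 lt0n.
have f0 : s`!%:R != 0 :> R by rewrite nz ?fact_gt0.
have total_gt0 : 0 < \sum_i \sum_j W i j.
  by rewrite total !mulr_gt0 ?exprn_gt0 ?ltr0n ?fact_gt0.
have a01 i : 0 <= a (supp i) <= 1 by rewrite /a; case: (_ \in _); rewrite ler01 lexx.
have b01 i : 0 <= b (supp i) <= 1.
  rewrite /b divr_ge0 ?ler0n //= ler_pdivrMr ?ltr0n // mul1r ler_nat.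
  by rewrite -(subcount_ksubsets _ _ _ (supp i) (supp_s i)) subcount_subset.
have mean_a : mean R _ W (fun i => a (supp i)) = density R H s S.
  rewrite /mean sum_dg total /density.
  have -> : \sum_(x in ksubsets V s) (deg H x)%:R * a x = (vol H S)%:R.
    rewrite /vol natr_sum (big_setID S) /= (setIidPr hS).
    rewrite [X in _ + X]big1 ?addr0 => [|x]; last first.
      by rewrite inE /a => /andP[/negPf->]; rewrite mulr0.
    by apply: eq_bigr => x xS; rewrite /a xS mulr1.
  by field; rewrite f0 !nz.
have mean_b : mean R _ W (fun i => b (supp i)) = density R H t T.
  rewrite /mean sum_dg total /density.
  have -> : \sum_(y in ksubsets V s) (deg H y)%:R * b y =
      'C(r - t, s - t)%:R * (vol H T)%:R / 'C(s, t)%:R.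
    rewrite -natrM -(sum_deg_subcount _ _ _ _ _ _ hts hH hT) natr_sum mulr_suml.
    by apply: eq_bigr => y _; rewrite natrM /b mulrA.
  have volstR : 'C(r - t, s - t)%:R * (vol H (ksubsets V t))%:R =
      (vol H (ksubsets V s))%:R * 'C(s, t)%:R :> R by rewrite -!natrM volst.
  (* Expressed through the volume of the [t]-sets, the denominator carries the same ratio of
     binomials as the numerator. *)
  have -> : (vol H (ksubsets V s))%:R =
      'C(r - t, s - t)%:R * (vol H (ksubsets V t))%:R / 'C(s, t)%:R :> R.
    by rewrite volstR mulfK ?nz.
  by field; rewrite f0 !nz.
have formE : (\sum_i \sum_j W i j * (a (supp i) * b (supp j))) / (\sum_i \sum_j W i j)
    = edge_density R H s t S T.
  (* One [s!] comes from each endpoint, ['C(r - s - t, s - t)] from [edges_sub], and ['C(s, t)] from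
     the normalization of [b]. *)
  have -> : \sum_i \sum_j W i j * (a (supp i) * b (supp j)) =
      s`!%:R ^+ 2 * 'C(r - s - t, s - t)%:R * #|edges_between H S T|%:R / 'C(s, t)%:R.
    under eq_bigr => i _ do under eq_bigr => j _ do rewrite WE.
    under eq_bigr => i _ do
      rewrite (sum_dtuple _ _ _ (fun y => (codeg H (supp i) y)%:R * (a (supp i) * b y))).
    rewrite -mulr_sumr (sum_dtuple _ _ _
      (fun x => \sum_(y in ksubsets V s) (codeg H x y)%:R * (a x * b y))).
    rewrite -[s`!%:R ^+ 2 * _ * _]mulrA -natrM edges_sub natr_sum.
    rewrite mulrA -expr2 -mulrA; congr (_ * _).
    rewrite (big_setID S) /= (setIidPr hS) [X in _ + X]big1 ?addr0 => [|x]; last first.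
      by rewrite inE => /andP[/negPf xS _]; apply: big1 => y _; rewrite /a xS mul0r mulr0.
    rewrite mulr_suml; apply: eq_bigr => x xS; rewrite natr_sum mulr_suml.
    by apply: eq_bigr => y _; rewrite natrM /a /b xS mul1r mulrA.
  rewrite total /edge_density.
  have fullR : 'C(r - s - t, s - t)%:R * #|edges_between H (ksubsets V s) (ksubsets V t)|%:R =
    'C(r - s, s)%:R * (vol H (ksubsets V s))%:R * 'C(s, t)%:R :> R.
    by rewrite -!natrM edges_full.
  have -> : #|edges_between H (ksubsets V s) (ksubsets V t)|%:R =
    'C(r - s, s)%:R * (vol H (ksubsets V s))%:R * 'C(s, t)%:R / 'C(r - s - t, s - t)%:R :> R.
    by rewrite -fullR mulrAC mulfV ?mul1r ?nz.
  by field; rewrite f0 !nz.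
have := weighted_mixing _ _ W symW W_ge0 dg_gt0 _ _ total_gt0 a01 b01.
(* For [W] the adjacency matrix, [nontrivial_radius] of the spectrum of [normalized_laplacian W]
   unfolds to [lambda_bar]. *)
by rewrite mean_a mean_b formE !density_setD -?lt0n.
Qed.
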